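(* In the two-producer electricity market model described in the context, suppose $A_i,B_i,\bar b_i,\bar c_i$ are positive for $i=1,2$, and that at least one of the following conditions holds: (i) $2\bar b_1\le\bar b_2$ and $2A_1+B_2+\bar b_1-2\bar b_2\ge0$; (ii) $\bar b_1\ge2\bar b_2$ and $2A_2+B_1-2\bar b_1+\bar b_2\ge0$. Let $(y_k)$ be the sequence generated by the proximal point algorithm described in the context. Then for any cluster point $\tilde y$ of $(y_k)$, the vector $\tilde\phi=P_{\mathcal{C}}(\tilde y)$ is a projected solution of the electricity market.
   Context: Two producers $i=1,2$ with production costs $A_iq^2+B_iq$; demand $1$; breakpoints $q_0=0,q_1=\frac12,q_2=1$; all bid functions are elements of $L^2([0,1],\mathbb{R})$, and pairs of bid functions lie in the Hilbert space $H=L^2([0,1])^2$ with its usual inner product. Fixed price bounds $p_{i,j}^{\min}\le p_{i,j}^{\max}$ ($j=0,1$) with $p_{i,0}^{\max}<p_{i,1}^{\min}$. $C_i$ is the set of piecewise linear functions $\phi_i$ on $[0,1]$ of the form $\phi_i(q)=p_i^0q+p_i^0$ for $q\in[0,\frac12]$ and $\phi_i(q)=p_i^1q+p_i^0+\frac12(p_i^0-p_i^1)$ for $q\in[\frac12,1]$, with $p_i^j\in[p_{i,j}^{\min},p_{i,j}^{\max}]$. $\mathcal{C}=C_1\times C_2$, a closed convex set; $P_{\mathcal{C}}$ is the projection onto $\mathcal{C}$ in $H$. Fixed bounds $0\le\underline b_i\le\bar b_i$, $0\le\underline c_i\le\bar c_i$ with $\bar c_i\ge p_{i,0}^{\max}$.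 For $\phi\in\mathcal{C}$ (with $\phi_i$ given by $p_i^0,p_i^1$), $K_i(\phi)$ is the set of quadratic functions $y_i(q)=A_iq^2+b_iq+c_i$ with $b_i\in[\underline b_i,\bar b_i]$, $c_i\in[\underline c_i,\bar c_i]$ and $c_i\ge p_i^0$. $\mathcal{K}(\phi)=K_1(\phi)\times K_2(\phi)$, and $\mathcal{A}=\overline{\mathrm{co}}\big(\bigcup_{\phi\in\mathcal{C}}\mathcal{K}(\phi)\big)$ is the closure of the convex hull. (The paper identifies these functions isometrically with vectors in $\mathbb{R}^{6}$ each.) For $y=(A_iq^2+b_iq+c_i)_{i=1}^2$ and $z=(A_iq^2+v_iq+w_i)_{i=1}^2$ in $\mathcal{A}$, $$f(y,z)=\frac{1}{2(A_1+A_2)}\Big[(b_1-v_1)(2A_2+B_1-2b_1+b_2)+(b_2-v_2)(2A_1+B_2+b_1-2b_2)\Big]+(c_1+c_2-w_1-w_2).$$ Projected solution of the electricity market: $\tilde\phi\in\mathcal{C}$ for which there is $\tilde y=(A_iq^2+\tilde b_iq+\tilde c_i)_{i=1}^2\in\mathcal{K}(\tilde\phi)$ such that (a) $\tilde\phi=P_{\mathcal{C}}(\tilde y)$, and (b) for each $i$, $(\tilde b_i,\tilde c_i)$ maximizes $(b_i-B_i)q_i(b)+c_i$ over all $(b_i,c_i)$ such that $A_iq^2+b_iq+c_i\in K_i(\tilde\phi)$, where $b=(b_i,\tilde b_{-i})$ and $q_i(b)=\frac1{2A_i}\left[\frac{2A_1A_2+A_{-i}b_i+A_ib_{-i}}{A_1+A_2}-b_i\right]$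 ($-i$ denotes the other producer). Proximal point algorithm: given a pair of quadratic functions $y_0=(A_i^0q^2+b_i^0q+c_i^0)_{i=1}^2$ and a bounded sequence $(\gamma_k)$ of positive reals, for $k=0,1,2,\dots$ let $\phi_k=P_{\mathcal{C}}(y_k)$, let $f_k(x,y)=f(x,y)+\gamma_k\langle x-y_k,y-x\rangle_H$ for $x,y\in\mathcal{A}$, and let $y_{k+1}$ be the unique point of $\mathcal{K}(\phi_k)$ such that $f_k(y_{k+1},y)\ge0$ for all $y\in\mathcal{K}(\phi_k)$. The stopping test is disregarded. *)

(* Defs.v *)
From mathcomp Require Import all_boot all_order all_algebra.
From mathcomp Require Import all_classical all_reals all_analysis.
Import Order.TTheory GRing.Theory Num.Theory.
Import numFieldNormedType.Exports.

Set Implicit Arguments.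
Unset Strict Implicit.
Unset Printing Implicit Defensive.

Local Open Scope classical_set_scope.
Local Open Scope ring_scope.

(* Producers 1, 2 and price indices j = 0, 1 are both encoded by
   [ord0, ord_max : 'I_2]; the opponent -i of producer i is [rev_ord i]. *)

Definition mu01 (R : realType) : {measure set (measurableTypeR R) -> \bar R} :=
  mrestr (@lebesgue_measure R) (measurable_itv `[0, 1]).

(* Elements of H are handled through representatives, functions on R of which
   only the values on [0,1] (up to null sets) matter. *)
Definition bidpair (R : realType) := 'I_2 -> R -> R.

Definition inH (R : realType) (x : bidpair R) : Prop :=
  forall i, x i \in Lfun (@mu01 R) 2%:E.

Definition innerH (R : realType) (x y : bidpair R) : R :=
  \sum_(i < 2) \int[@mu01 R]_q (x i q * y i q).

Definition normH (R : realType) (x : bidpair R) : R :=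
  Num.sqrt (innerH x x).

Definition projH (R : realType) (S : set (bidpair R)) (x : bidpair R) :
    bidpair R :=
  get [set z | S z /\ forall w, S w -> normH (x - z) <= normH (x - w)].

Definition cluster_point (R : realType) (u : nat -> bidpair R)
    (x : bidpair R) : Prop :=
  forall e : R, 0 < e -> forall N : nat,
    exists2 k, (N <= k)%N & normH (u k - x) < e.

Record market (R : realType) := Market {
  costA : 'I_2 -> R;
  costB : 'I_2 -> R;
  pmin : 'I_2 -> 'I_2 -> R; (* producer, then price index *)
  pmax : 'I_2 -> 'I_2 -> R;
  bmin : 'I_2 -> R;
  bmax : 'I_2 -> R;
  cmin : 'I_2 -> R;
  cmax : 'I_2 -> R
}.

(* Continuous at 1/2, where both formulas apply. *)
Definition pwl (R : realType) (p : 'I_2 -> R) (q : R) : R :=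
  if q <= 1 / 2 then p ord0 * q + p ord0
  else p ord_max * q + p ord0 + 1 / 2 * (p ord0 - p ord_max).

Definition Ci (R : realType) (M : market R) (i : 'I_2) : set (R -> R) :=
  [set phi | exists p : 'I_2 -> R,
     (forall j, pmin M i j <= p j <= pmax M i j) /\ phi = pwl p].

Definition calC (R : realType) (M : market R) : set (bidpair R) :=
  [set phi | forall i, Ci M i (phi i)].

(* The quadratic function q |-> qa q^2 + qb q + qc. *)
Record quad (R : realType) := Quad { qa : R; qb : R; qc : R }.

Definition quads (R : realType) (y : 'I_2 -> quad R) : bidpair R :=
  fun i q => qa (y i) * q ^+ 2 + qb (y i) * q + qc (y i).

(* [phi] determines [p], as p_0 = phi(0) and p_1 = 2 (phi(1) - phi(1/2)). *)
Definition Ki (R : realType) (M : market R) (i : 'I_2) (phi : R -> R) :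
    set (quad R) :=
  [set y | [/\ qa y = costA M i,
               bmin M i <= qb y <= bmax M i,
               cmin M i <= qc y <= cmax M i
             & exists p : 'I_2 -> R, phi = pwl p /\ p ord0 <= qc y]].

Definition calK (R : realType) (M : market R) (phi : bidpair R) :
    set ('I_2 -> quad R) :=
  [set y | forall i, Ki M i (phi i) (y i)].

(* Meant for pairs with leading coefficients A_1, A_2. All elements of the
   closed convex hull of the union of the sets K(phi) are such pairs; the
   formula needs no further restriction of its domain. *)
Definition bif (R : realType) (M : market R) (y z : 'I_2 -> quad R) : R :=
  let A1 := costA M ord0 in let A2 := costA M ord_max in
  let B1 := costB M ord0 in let B2 := costB M ord_max in
  let b1 := qb (y ord0) in let b2 := qb (y ord_max) in
  let c1 := qc (y ord0) in let c2 := qc (y ord_max) in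
  let v1 := qb (z ord0) in let v2 := qb (z ord_max) in
  let w1 := qc (z ord0) in let w2 := qc (z ord_max) in
  1 / (2 * (A1 + A2)) *
    ((b1 - v1) * (2 * A2 + B1 - 2 * b1 + b2)
     + (b2 - v2) * (2 * A1 + B2 + b1 - 2 * b2))
  + (c1 + c2 - w1 - w2).

(* The quantity q_i(b); [bi] and [bo] are the bids of i and of the other
   producer. *)
Definition quantity (R : realType) (M : market R) (i : 'I_2) (bi bo : R) : R :=
  let Ai := costA M i in let Ao := costA M (rev_ord i) in
  1 / (2 * Ai) * ((2 * Ai * Ao + Ao * bi + Ai * bo) / (Ai + Ao) - bi).

Definition profit (R : realType) (M : market R) (i : 'I_2) (bi bo ci : R) : R :=
  (bi - costB M i) * quantity M i bi bo + ci.

Definition projected_solution (R : realType) (M : market R)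
    (phi : bidpair R) : Prop :=
  calC M phi /\
  exists y : 'I_2 -> quad R,
    [/\ calK M phi y,
        phi = projH (calC M) (quads y)
      & forall i (z : quad R), Ki M i (phi i) z ->
          profit M i (qb z) (qb (y (rev_ord i))) (qc z)
            <= profit M i (qb (y i)) (qb (y (rev_ord i))) (qc (y i))].

Definition bif_prox (R : realType) (M : market R) (gamma : R)
    (yk x y : 'I_2 -> quad R) : R :=
  bif M x y + gamma * innerH (quads x - quads yk) (quads y - quads x).

Definition prox_solutions (R : realType) (M : market R) (gamma : R)
    (yk : 'I_2 -> quad R) : set ('I_2 -> quad R) :=
  let phik := projH (calC M) (quads yk) in
  [set x | calK M phik x /\
           forall y, calK M phik y -> 0 <= bif_prox M gamma yk x y].

Definition proximal_point (R : realType) (M : market R) (gamma : nat -> R)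
    (y : nat -> 'I_2 -> quad R) : Prop :=
  forall k, prox_solutions M (gamma k) (y k) = [set y k.+1].

(* Main.v *)
Require Import Defs.
From mathcomp Require Import all_boot all_order all_algebra.
From mathcomp Require Import all_classical all_reals all_analysis.
From mathcomp Require Import measurable_realfun ring lra.
Import Order.TTheory GRing.Theory Num.Theory.
Import numFieldNormedType.Exports.
Local Open Scope classical_set_scope.
Local Open Scope ring_scope.

(* The pair of maximal bids, b_i = bmax_i and c_i = cmax_i, belongs to K(phi)
   for every phi in C, because cmax_i >= pmax_i0. Either condition (i) or (ii)
   makes the marginal profit of each producer in b_i nonnegative at the maximal
   bids, and the quadratic part of the bifunction is strongly monotone. Hence
   the maximal bids are an equilibrium in every K(phi), and a proximal step
   multiplies the squared distance to them by at most a constant r < 1 that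
   depends only on the bound of (gamma_k). The whole sequence thus converges to
   the maximal bids, the only possible cluster point up to a null set. *)

(** * Inner products of square-integrable functions, and minima of quadratics on a rectangle *)

Lemma Lfun2_bounded {d : measure_display} {T : measurableType d} {R : realType}
    (mu : {measure set T -> \bar R}) (f : T -> R) (C : R) :
  (mu setT < +oo)%E -> measurable_fun setT f ->
  {ae mu, forall x, `|f x| <= C} -> f \in Lfun mu 2%:E.
Proof.
move=> mufin mf fC; rewrite inE; apply/andP; split; rewrite inE//=.
rewrite /finite_norm unlock poweR_lty//.
have h : (\int[mu]_x `|((f x) ^+ 2)%:E| <= (C ^+ 2)%:E * mu setT)%E.
  apply: integral_le_bound => //.
  - by apply/measurable_EFinP; exact: measurable_funX.
  - by rewrite lee_fin sqr_ge0.
  - apply: filterS fC => x fC _; rewrite abse_EFin lee_fin ger0_norm ?sqr_ge0//.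
    rewrite -real_normK ?num_real//.
    by rewrite lerXn2r ?nnegrE// (le_trans _ fC).
apply: (@le_lt_trans _ _ ((C ^+ 2)%:E * mu setT)%E).
  apply: le_trans h; rewrite le_eqVlt; apply/orP; left; apply/eqP.
  apply: eq_integral => x _.
  by rewrite /= powR_mulrn// real_normK ?num_real// ger0_norm ?sqr_ge0.
by rewrite lte_mul_pinfty// lee_fin sqr_ge0.
Qed.

(** [innerH] is by conversion the sum over the two producers of this form at [mu01]. On
    representatives it is only a semi-inner product: [ip mu f f = 0] does not make [f] the zero
    function. *)
Definition ip {d : measure_display} {T : measurableType d} {R : realType}
    (mu : {measure set T -> \bar R}) (f g : T -> R) : R :=
  \int[mu]_x (f x * g x).

Lemma ipC {d : measure_display} {T : measurableType d} {R : realType}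
    (mu : {measure set T -> \bar R}) (f g : T -> R) : ip mu f g = ip mu g f.
Proof. by apply: eq_Rintegral => x _; rewrite mulrC. Qed.

Lemma ip_linear {d : measure_display} {T : measurableType d} {R : realType}
    (mu : {measure set T -> \bar R}) (f g h : T -> R) (a : R) :
  f \in Lfun mu 2%:E -> g \in Lfun mu 2%:E -> h \in Lfun mu 2%:E ->
  ip mu (a *: f + g) h = a * ip mu f h + ip mu g h.
Proof.
move=> Lf Lg Lh.
have int u : u \in Lfun mu 2%:E -> mu.-integrable setT (EFin \o (u \* h)).
  by move=> Lu; apply/Lfun1_integrable; exact: Lfun2_mul_Lfun1.
rewrite /ip -RintegralZl//; last exact: int.
rewrite -RintegralD//; [|  |exact: int].
- by apply: eq_Rintegral => x _; rewrite mulrDl -mulrA.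
- exact: (integrableZl measurableT a (int _ Lf)).
Qed.

Lemma ip_ge0 {d : measure_display} {T : measurableType d} {R : realType}
    (mu : {measure set T -> \bar R}) (f : T -> R) : 0 <= ip mu f f.
Proof. by apply: Rintegral_ge0 => x _; rewrite -expr2 sqr_ge0. Qed.


Lemma Lfun2_linear {d : measure_display} {T : measurableType d} {R : realType}
    (mu : {measure set T -> \bar R}) (u v : T -> R) (a : R) :
  u \in Lfun mu 2%:E -> v \in Lfun mu 2%:E -> a *: u + v \in Lfun mu 2%:E.
Proof. by move=> Lu Lv; exact: (Lfun_submod_closed mu (lee1n 2)).2. Qed.

(** The free scalar [a] serves three ends: expanding squared distances, the parallelogram identity
    ([a] = 1 and -1), and a discriminant argument. *)
Lemma ip_sqrD {d : measure_display} {T : measurableType d} {R : realType}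
    (mu : {measure set T -> \bar R}) (u v : T -> R) (a : R) :
  u \in Lfun mu 2%:E -> v \in Lfun mu 2%:E ->
  ip mu (a *: u + v) (a *: u + v) =
  a ^+ 2 * ip mu u u + 2 * a * ip mu u v + ip mu v v.
Proof.
move=> Lu Lv; have Lw : a *: u + v \in Lfun mu 2%:E.
  by apply: Lfun2_linear.
rewrite ip_linear// (ipC _ u) (ipC _ v) !ip_linear// (ipC _ v u); ring.
Qed.

(** Extreme value theorem on a compact rectangle. It yields projections onto [calC], since the
    squared distance to [pwl p] is quadratic in the two parameters of [p]. *)
Lemma quadratic_min_box {R : realType} (a b c d : R) (k : R -> R -> R)
    (c0 c1 c2 c3 c4 c5 : R) :
  a <= b -> c <= d ->
  (forall s t, k s t = c0 * s ^+ 2 + c1 * s * t + c2 * t ^+ 2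
                       + c3 * s + c4 * t + c5) ->
  exists s t, [/\ a <= s <= b, c <= t <= d &
    forall s' t', a <= s' <= b -> c <= t' <= d -> k s t <= k s' t'].
Proof.
move=> ab cd kE; pose A := `[a, b]%classic `*` `[c, d]%classic.
have A0 : A !=set0 by exists (a, c); split; rewrite /= in_itv/= lexx.
have cA : compact A by apply: compact_setX; exact: segment_compact.
have ck : continuous (fun z : R * R => k z.1 z.2).
  rewrite (_ : (fun z : R * R => k z.1 z.2) = (fun z => c0 * (z.1 * z.1)
      + c1 * (z.1 * z.2) + c2 * (z.2 * z.2) + c3 * z.1 + c4 * z.2 + c5)).
    move=> z; have cf : z'.1 @[z' --> z] --> z.1 by exact: cvg_fst.
    have cs : z'.2 @[z' --> z] --> z.2 by exact: cvg_snd.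
    by do !apply: cvgD; try apply: cvgM => //; try apply: cvgM => //;
      try exact: cvg_cst.
  by apply/funext => z; rewrite kE; ring.
have [|[s t] /set_mem[/= sab tcd] km] :=
  compact_EVT_min A0 cA (f := fun z => k z.1 z.2).
  exact: continuous_subspaceT.
exists s, t; split; [by move: sab; rewrite in_itv|by move: tcd; rewrite in_itv|].
move=> s' t' hs ht; apply: (km (s', t')).
by apply/mem_set; split; rewrite /= in_itv.
Qed.

(** * Lebesgue measure on the unit interval and the bid functions *)

Lemma mu01_fin (R : realType) : (mu01 R setT < +oo)%E.
Proof.
rewrite /= /mrestr setTI lebesgue_measure_itv/= lte_fin ltr01.
by rewrite oppr0 addr0 ltry.
Qed.

Lemma mu01_ae (R : realType) : {ae mu01 R, forall q : R, 0 <= q <= 1}.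
Proof.
exists (~` `[0, 1]%classic); split.
- by apply: measurableC; exact: measurable_itv.
- by rewrite /= /mrestr setICl measure0.
- by move=> q /=; rewrite in_itv.
Qed.

(** [mu01] is a measure on the whole line, where bids may be unbounded, but it gives no mass to the
    complement of [0,1]; a bound on [0,1] is thus a bound almost everywhere. *)
Lemma Lfun01_bounded {R : realType} (f : R -> R) (C : R) :
  measurable_fun setT f -> (forall q, 0 <= q <= 1 -> `|f q| <= C) ->
  f \in Lfun (mu01 R) 2%:E.
Proof.
move=> mf fC; apply: (@Lfun2_bounded _ _ _ _ _ C) => //; first exact: mu01_fin.
apply: (@filterS _ _ (ae_filter_ringOfSetsType (mu01 R)) _ _ fC); exact: mu01_ae.
Qed.

Lemma Lfun01_quad {R : realType} (a b c : R) :
  (fun q => a * q ^+ 2 + b * q + c) \in Lfun (mu01 R) 2%:E.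
Proof.
apply: (@Lfun01_bounded _ _ (`|a| + `|b| + `|c|)).
  apply: measurable_funD => //; apply: measurable_funD; apply: measurable_funM => //.
move=> q /andP[q0 q1]; rewrite (le_trans (ler_normD _ _))// lerD2r.
rewrite (le_trans (ler_normD _ _))// !normrM !(ger0_norm q0).
by apply: lerD; apply: ler_piMr => //; rewrite mulr_ile1.
Qed.

Lemma Lfun01_pwl {R : realType} (p : 'I_2 -> R) :
  pwl p \in Lfun (mu01 R) 2%:E.
Proof.
(* Left of 1/2 the value is [(q + 1) * p ord0], and right of it
   [3/2 * p ord0 + (q - 1/2) * p ord_max]. *)
apply: (@Lfun01_bounded _ _ (2 * `|p ord0| + `|p ord_max|)).
  apply: measurable_fun_ifT => //=.
  - exact: measurable_fun_ler.
  - by do !apply: measurable_funD => //; apply: measurable_funM.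
  - by do !apply: measurable_funD => //; apply: measurable_funM.
have := ler_norm (p ord0); have := ler_norm (- p ord0).
have := ler_norm (p ord_max); have := ler_norm (- p ord_max).
rewrite !normrN => h1 h2 h3 h4.
move=> q /andP[q0 q1]; rewrite /pwl ler_norml; case: ifPn => [qh|].
  apply/andP; split; nra.
rewrite -ltNge => qh; apply/andP; split; nra.
Qed.

(** The unit vectors of the parameter plane; the two functions [pwl (hat R j)] span all the
    [pwl p]. *)
Definition hat (R : realType) (j k : 'I_2) : R := (k == j)%:R.

Lemma pwlE {R : realType} (p : 'I_2 -> R) :
  pwl p = p ord0 *: pwl (hat R ord0) + p ord_max *: pwl (hat R ord_max).
Proof.
apply/funext => q; rewrite /pwl /hat /=.
rewrite !fctE /= /GRing.scale/=; case: ifP => _; ring.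
Qed.

(** By the parallelogram identity, the two sides differ by the square of [v - u]. This replaces the
    triangle inequality and keeps everything in squared norms. *)
Lemma ip_sqrD_le {d : measure_display} {T : measurableType d} {R : realType}
    (mu : {measure set T -> \bar R}) (u v : T -> R) :
  u \in Lfun mu 2%:E -> v \in Lfun mu 2%:E ->
  ip mu (u + v) (u + v) <= 2 * ip mu u u + 2 * ip mu v v.
Proof.
move=> Lu Lv; have := ip_sqrD mu u v 1 Lu Lv; have := ip_sqrD mu u v (-1) Lu Lv.
have := ip_ge0 mu (-1 *: u + v); rewrite scale1r; lra.
Qed.

(* [a^2 |u|^2 + 2 a <u, v> + |v|^2 >= 0] for every [a] forces [<u, v> = 0]
   when [|u| = 0]. *)
Lemma ip_sqrD_null {d : measure_display} {T : measurableType d} {R : realType}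
    (mu : {measure set T -> \bar R}) (u v : T -> R) :
  u \in Lfun mu 2%:E -> v \in Lfun mu 2%:E -> ip mu u u = 0 ->
  ip mu (u + v) (u + v) = ip mu v v.
Proof.
move=> Lu Lv u0; suff uv0 : ip mu u v = 0.
  by have := ip_sqrD mu u v 1 Lu Lv; rewrite scale1r u0 uv0 !mulr0 !add0r.
apply/eqP; apply/negPn/negP => uv.
pose a := - (ip mu v v + 1) / (2 * ip mu u v).
have := ip_ge0 mu (a *: u + v); rewrite ip_sqrD// u0 mulr0 add0r.
have -> : 2 * a * ip mu u v = - (ip mu v v + 1) by rewrite /a; field.
lra.
Qed.

(** * Projection onto [calC] *)

Lemma ord2_ind (P : 'I_2 -> Prop) : P ord0 -> P ord_max -> forall i, P i.
Proof.
move=> P0 P1 [[|[|//]] lti].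
- by rewrite (_ : Ordinal lti = ord0)//; exact: val_inj.
- by rewrite (_ : Ordinal lti = ord_max)//; exact: val_inj.
Qed.

Lemma sum_ord2 {R : realType} (F : 'I_2 -> R) :
  \sum_(i < 2) F i = F ord0 + F ord_max.
Proof.
rewrite big_ord_recl big_ord1; congr (_ + F _); exact: val_inj.
Qed.

(** [Ci] is the image of a rectangle under the linear map [pwl], so a nearest point comes from
    minimising a quadratic in two variables. *)
Lemma Ci_nearest {R : realType} (M : market R) (i : 'I_2) (f : R -> R) :
  (forall j, pmin M i j <= pmax M i j) -> f \in Lfun (mu01 R) 2%:E ->
  exists z, Ci M i z /\ forall w, Ci M i w ->
    ip (mu01 R) (f - z) (f - z) <= ip (mu01 R) (f - w) (f - w).
Proof.
move=> hp Lf; set e0 := pwl (hat R ord0); set e1 := pwl (hat R ord_max).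
have Le0 : e0 \in Lfun (mu01 R) 2%:E by exact: Lfun01_pwl.
have Le1 : e1 \in Lfun (mu01 R) 2%:E by exact: Lfun01_pwl.
(* The difference [f - s *: e0 - t *: e1] is nested so that [ip_sqrD] applies twice; the
   coefficients passed to [quadratic_min_box] are read off from that expansion. *)
pose k s t := let g := - s *: e0 + (- t *: e1 + f) in ip (mu01 R) g g.
have pwlk p : ip (mu01 R) (f - pwl p) (f - pwl p) = k (p ord0) (p ord_max).
  rewrite pwlE /k (_ : f - _ = - p ord0 *: e0 + (- p ord_max *: e1 + f))//.
  by rewrite opprD !scaleNr addrC addrA.
have [||s t|s [t [hs ht kst]]] := @quadratic_min_box R (pmin M i ord0)
    (pmax M i ord0) (pmin M i ord_max) (pmax M i ord_max) k
    (ip (mu01 R) e0 e0) (2 * ip (mu01 R) e1 e0) (ip (mu01 R) e1 e1)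
    (- 2 * ip (mu01 R) f e0) (- 2 * ip (mu01 R) e1 f) (ip (mu01 R) f f).
- exact: hp.
- exact: hp.
- have Lv := Lfun2_linear _ _ _ (- t) Le1 Lf.
  rewrite /k ip_sqrD// ip_sqrD//.
  have -> : ip (mu01 R) e0 (- t *: e1 + f) =
      - t * ip (mu01 R) e1 e0 + ip (mu01 R) f e0.
    by rewrite ipC; exact: ip_linear.
  ring.
exists (pwl (fun j => if j == ord0 then s else t)); split.
  by exists (fun j => if j == ord0 then s else t); split => //; exact: ord2_ind.
by move=> w [p [hpp ->]]; rewrite !pwlk/=; exact: kst.
Qed.

Lemma inH_quads {R : realType} (y : 'I_2 -> quad R) : inH (quads y).
Proof. by move=> i; exact: Lfun01_quad. Qed.

Lemma inH_calC {R : realType} (M : market R) (w : bidpair R) :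
  calC M w -> inH w.
Proof. by move=> Cw i; have [p [_ ->]] := Cw i; exact: Lfun01_pwl. Qed.

Lemma inHB {R : realType} (u v : bidpair R) : inH u -> inH v -> inH (u - v).
Proof.
move=> Hu Hv i; rewrite (_ : (u - v) i = -1 *: v i + u i); first exact: Lfun2_linear.
by rewrite scaleN1r addrC.
Qed.

Lemma innerH_ge0 {R : realType} (u : bidpair R) : 0 <= innerH u u.
Proof. by apply: sumr_ge0 => i _; exact: ip_ge0. Qed.

(** [get] meets its specification only if a minimiser exists. The squared norm is a sum over
    producers, so one is assembled from nearest points in each [Ci]. *)
Lemma calC_projH {R : realType} (M : market R) (x : bidpair R) :
  (forall i j, pmin M i j <= pmax M i j) -> inH x -> calC M (projH (calC M) x).
Proof.
move=> hp Hx; have /choice[z zP] i := Ci_nearest M i (x i) (hp i) (Hx i).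
suff [] : calC M (projH (calC M) x) /\ forall w, calC M w ->
  normH (x - projH (calC M) x) <= normH (x - w) by [].
apply: (@getPex _ [set z | calC M z /\
  forall w, calC M w -> normH (x - z) <= normH (x - w)]).
exists z; split => [i|w Cw]; first exact: (zP i).1.
by apply: ler_wsqrtr; apply: ler_sum => i _; exact: (zP i).2.
Qed.

Lemma innerH_sqrD {R : realType} (u v : bidpair R) : inH u -> inH v ->
  innerH (u + v) (u + v) = innerH u u + 2 * innerH u v + innerH v v.
Proof.
move=> Hu Hv; rewrite /innerH mulr_sumr -!big_split/=.
apply: eq_bigr => i _; have := ip_sqrD (mu01 R) (u i) (v i) 1 (Hu i) (Hv i).
by rewrite scale1r expr1n mul1r mulr1.
Qed.

Lemma innerH_sqrD_le {R : realType} (u v : bidpair R) : inH u -> inH v ->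
  innerH (u + v) (u + v) <= 2 * innerH u u + 2 * innerH v v.
Proof.
move=> Hu Hv; rewrite /innerH !mulr_sumr -big_split/=.
by apply: ler_sum => i _; exact: ip_sqrD_le.
Qed.

(** Points at distance zero may differ as functions, but they have the same distance to every
    element of [calC]. The two sets of nearest points are then equal, and [get] picks the same
    element from both. *)
Lemma projH_null {R : realType} (M : market R) (x y : bidpair R) :
  inH x -> inH y -> innerH (x - y) (x - y) = 0 ->
  projH (calC M) x = projH (calC M) y.
Proof.
move=> Hx Hy; move/eqP; rewrite psumr_eq0 => [/allP xy0|i _]; last exact: ip_ge0.
have norm_xy w : calC M w -> normH (x - w) = normH (y - w).
  move=> Cw; congr Num.sqrt; apply: eq_bigr => i _.
  have -> : (x - w) i = (x - y) i + (y - w) i.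
    by rewrite -[RHS]/(((x - y) + (y - w)) i) addrA subrK.
  apply: ip_sqrD_null; first exact: inHB; last exact/eqP/xy0/mem_index_enum.
  by apply: inHB => //; exact: inH_calC Cw.
congr get; apply/seteqP; split => z [Cz zmin]; split => // w Cw.
- by rewrite -!norm_xy//; exact: zmin.
- by rewrite !norm_xy//; exact: zmin.
Qed.

(** * The maximal bids and the contraction of a proximal step *)

Lemma ipZZ {d : measure_display} {T : measurableType d} {R : realType}
    (mu : {measure set T -> \bar R}) (u : T -> R) (a : R) :
  u \in Lfun mu 2%:E -> ip mu (a *: u) (a *: u) = a ^+ 2 * ip mu u u.
Proof.
move=> Lu; rewrite /ip -RintegralZl//.
  by apply: eq_Rintegral => x _; rewrite /= !fctE /GRing.scale/=; ring.
by apply/Lfun1_integrable; exact: Lfun2_mul_Lfun1.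
Qed.

(** Equal leading coefficients cancel, which leaves a combination of [id] and the constant 1. Only
    the nonnegativity of their two squared norms is used later. *)
Lemma innerH_subquads_le {R : realType} (y x : 'I_2 -> quad R) :
  (forall i, qa (y i) = qa (x i)) ->
  innerH (quads y - quads x) (quads y - quads x) <=
  \sum_(i < 2) (2 * (qb (y i) - qb (x i)) ^+ 2 * ip (mu01 R) id id
                + 2 * (qc (y i) - qc (x i)) ^+ 2 * ip (mu01 R) (cst 1) (cst 1)).
Proof.
move=> eqa; apply: ler_sum => i _.
have L1 : (@cst R R 1) \in Lfun (mu01 R) 2%:E.
  by apply: (@Lfun01_bounded _ _ 1) => // q _ /=; rewrite normr1.
have Lid : (@id R) \in Lfun (mu01 R) 2%:E.
  by apply: (@Lfun01_bounded _ _ 1) => // q /andP[q0 q1]; rewrite ger0_norm.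
have LZ u a : u \in Lfun (mu01 R) 2%:E -> a *: u \in Lfun (mu01 R) 2%:E.
  move=> Lu; rewrite -[a *: u]addr0; apply: Lfun2_linear => //.
  exact: (Lfun_submod_closed _ (lee1n 2)).1.
have -> : (quads y - quads x) i =
    (qb (y i) - qb (x i)) *: id + (qc (y i) - qc (x i)) *: cst 1.
  by apply/funext => q; rewrite /quads !fctE /GRing.scale/= eqa; ring.
by rewrite (le_trans (ip_sqrD_le _ _ _ (LZ _ _ Lid) (LZ _ _ L1)))// !ipZZ// !mulrA.
Qed.

Definition max_bids {R : realType} (M : market R) : 'I_2 -> quad R :=
  fun i => Quad (costA M i) (bmax M i) (cmax M i).

Lemma calK_max_bids {R : realType} (M : market R) (phi : bidpair R) :
  (forall i, 0 <= bmin M i <= bmax M i) ->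
  (forall i, 0 <= cmin M i <= cmax M i) ->
  (forall i, pmax M i ord0 <= cmax M i) ->
  calC M phi -> calK M phi (max_bids M).
Proof.
move=> hb hc hcp Cphi i; have [p [hp phiE]] := Cphi i; split => //=.
- by have /andP[_ ->] := hb i; rewrite lexx.
- by have /andP[_ ->] := hc i; rewrite lexx.
- by exists p; split => //; rewrite (le_trans _ (hcp i))//; have /andP[] := hp ord0.
Qed.

(** With [d1], [d2] the gaps to the maximal slopes, the quadratic part is 2 d1^2 - 2 d1 d2 + 2 d2^2
    = d1^2 + d2^2 + (d1 - d2)^2. The last square and the two marginal terms are dropped, being
    nonnegative. *)
Lemma bif_max_bids_le {R : realType} (M : market R) (x : 'I_2 -> quad R) :
  (forall i, 0 < costA M i) ->
  0 <= 2 * costA M ord_max + costB M ord0 - 2 * bmax M ord0 + bmax M ord_max ->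
  0 <= 2 * costA M ord0 + costB M ord_max + bmax M ord0 - 2 * bmax M ord_max ->
  (forall i, qb (x i) <= bmax M i) ->
  bif M x (max_bids M) <=
  - \sum_(i < 2) (1 / (2 * (costA M ord0 + costA M ord_max))
                  * (bmax M i - qb (x i)) ^+ 2 + (cmax M i - qc (x i))).
Proof.
move=> hA G1 G2 xb; rewrite sum_ord2 /bif /max_bids /=.
have := hA ord0; have := hA ord_max.
set k := 1 / _ => A2 A1; have k0 : 0 < k by rewrite /k divr_gt0//; lra.
move: (xb ord0) (xb ord_max) G1 G2 => x0 x1.
set b1 := qb _; set b2 := qb (x ord_max) => G1 G2.
rewrite -subr_ge0; set t := (X in 0 <= X).
have -> : t = k * ((bmax M ord0 - b1) * (2 * costA M ord_max + costB M ord0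
      - 2 * bmax M ord0 + bmax M ord_max)
    + (bmax M ord_max - b2) * (2 * costA M ord0 + costB M ord_max
      + bmax M ord0 - 2 * bmax M ord_max)
    + ((bmax M ord0 - b1) - (bmax M ord_max - b2)) ^+ 2).
  by rewrite /t; ring.
apply: mulr_ge0; first exact: ltW.
by rewrite !addr_ge0 ?sqr_ge0// mulr_ge0// subr_ge0.
Qed.

(** The inequality defining [x] is tested at [max_bids M]. Its inner product is rewritten by
    expanding the square of (x - u) + (max - x), and the square of x - u is dropped. *)
Lemma prox_decrease {R : realType} (M : market R) (g : R)
    (u x : 'I_2 -> quad R) :
  (forall i j, pmin M i j <= pmax M i j) ->
  (forall i, 0 <= bmin M i <= bmax M i) ->
  (forall i, 0 <= cmin M i <= cmax M i) ->
  (forall i, pmax M i ord0 <= cmax M i) ->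
  0 < g -> prox_solutions M g u x ->
  innerH (quads (max_bids M) - quads x) (quads (max_bids M) - quads x)
    <= innerH (quads (max_bids M) - quads u) (quads (max_bids M) - quads u)
       + 2 / g * bif M x (max_bids M).
Proof.
move=> hp hb hc hcp g0 [_ /(_ (max_bids M))]; rewrite /bif_prox.
move=> /(_ (calK_max_bids _ _ hb hc hcp (calC_projH _ _ hp (inH_quads u)))).
have -> : quads (max_bids M) - quads u =
    (quads x - quads u) + (quads (max_bids M) - quads x).
  by rewrite [RHS]addrC addrA subrK.
rewrite (innerH_sqrD (quads x - quads u)); [|by apply: inHB; exact: inH_quads..].
have := innerH_ge0 (quads x - quads u).
set a := innerH (quads x - _) (quads x - _); set s := innerH _ _.
set t := innerH (quads (max_bids M) - _) _ => a0 h.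
suff : 0 <= 2 * s + 2 / g * bif M x (max_bids M) by lra.
rewrite (_ : _ + _ = 2 / g * (bif M x (max_bids M) + g * s)).
  by rewrite mulr_ge0// divr_ge0// ltW.
by field; rewrite gt_eqF.
Qed.

Lemma prox_contract {R : realType} (M : market R) (G : R)
  (hp : forall i j, pmin M i j <= pmax M i j)
  (hb : forall i, 0 <= bmin M i <= bmax M i)
  (hc : forall i, 0 <= cmin M i <= cmax M i)
  (hcp : forall i, pmax M i ord0 <= cmax M i)
  (hA : forall i, 0 < costA M i)
  (G1 : 0 <= 2 * costA M ord_max + costB M ord0
             - 2 * bmax M ord0 + bmax M ord_max)
  (G2 : 0 <= 2 * costA M ord0 + costB M ord_max
             + bmax M ord0 - 2 * bmax M ord_max) :
  exists r, 0 <= r < 1 /\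
    forall g u x, 0 < g <= G -> prox_solutions M g u x ->
    innerH (quads (max_bids M) - quads x) (quads (max_bids M) - quads x)
      <= r * innerH (quads (max_bids M) - quads u) (quads (max_bids M) - quads u).
Proof.
(* If [G <= 0], no [g] satisfies [0 < g <= G], so any ratio will do. *)
have [G0|G0] := leP G 0.
  exists 0; rewrite lexx ltr01; split => // g u x /andP[g0 gG].
  by have := lt_le_trans g0 (le_trans gG G0); rewrite ltxx.
pose k := 1 / (2 * (costA M ord0 + costA M ord_max)).
have k0 : 0 < k by rewrite divr_gt0// mulr_gt0// addr_gt0.
pose m2 : R := ip (mu01 R) id id; pose m0 : R := ip (mu01 R) (cst 1) (cst 1).
have m2_ge0 : 0 <= m2 by exact: ip_ge0.
have m0_ge0 : 0 <= m0 by exact: ip_ge0.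
(* [C] is chosen so that [a <= C * S] below: its first summand handles the [qb] gaps and its second
   the [qc] gaps, while the 1 makes it positive. The [qc] gaps enter [S] only linearly, so one
   factor of their square is bounded by the sum of the [cmax]. *)
pose C := 2 * m2 / k + 2 * m0 * (cmax M ord0 + cmax M ord_max) + 1.
have cmax0 i : 0 <= cmax M i by have /andP[c1 c2] := hc i; exact: le_trans c2.
have C0 : 0 < C.
  by rewrite ltr_wpDl// addr_ge0// ?divr_ge0 ?mulr_ge0 ?addr_ge0// ltW.
have GC0 : 0 < 2 / (G * C) by rewrite divr_gt0// mulr_gt0.
(* From [a + 2 / g * S <= b], [a <= C * S] and [g <= G] follows [(1 + 2 / (G * C)) * a <= b]. *)
exists ((1 + 2 / (G * C))^-1); split.
  by rewrite invr_ge0 addr_ge0 ?ltW//= invf_lt1 ?ltrDl// addr_gt0.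
move=> g u x /andP[g0 gG] ux.
have [Kx _] := ux.
have xA i : qa (max_bids M i) = qa (x i) by have [->] := Kx i.
have xb i : qb (x i) <= bmax M i by have [_ /andP[]] := Kx i.
have xc i : 0 <= qc (x i) <= cmax M i.
  have [_ _ /andP[cx ->] _] := Kx i; rewrite andbT (le_trans _ cx)//.
  by have /andP[] := hc i.
have dec := prox_decrease M g u x hp hb hc hcp g0 ux.
have upp := innerH_subquads_le (max_bids M) x xA.
have low := bif_max_bids_le M x hA G1 G2 xb.
set a := innerH _ _ in dec upp *; set b := innerH _ _ in dec *.
set S := \sum_(i < 2) _ in low.
have S0 : 0 <= S.
  apply: sumr_ge0 => i _; rewrite addr_ge0 ?subr_ge0//; last by have /andP[] := xc i.
  by rewrite mulr_ge0 ?sqr_ge0// ltW.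
have aCS : a <= C * S.
  rewrite (le_trans upp)// mulr_sumr; apply: ler_sum => i _.
  rewrite mulrDr -/k -/m2 -/m0 /=; apply: lerD.
    rewrite (mulrA C k) (_ : 2 * _ * m2 = (2 * m2) * (bmax M i - qb (x i)) ^+ 2);
      last by ring.
    rewrite ler_wpM2r ?sqr_ge0//.
    have -> : C * k = 2 * m2 + (2 * m0 * (cmax M ord0 + cmax M ord_max) + 1) * k.
      by rewrite /C; field; rewrite gt_eqF.
    by rewrite lerDl mulr_ge0 ?(ltW k0)// addr_ge0// !mulr_ge0// addr_ge0.
  have /andP[xc0 xc1] := xc i.
  rewrite (_ : 2 * _ * m0 =
      2 * m0 * (cmax M i - qc (x i)) * (cmax M i - qc (x i))); last by ring.
  rewrite ler_wpM2r ?subr_ge0//.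
  apply: (@le_trans _ _ (2 * m0 * (cmax M ord0 + cmax M ord_max))).
    rewrite ler_wpM2l ?mulr_ge0//.
    have : cmax M i <= cmax M ord0 + cmax M ord_max.
      by move: i {xc0 xc1}; apply: ord2_ind; rewrite ?lerDl ?lerDr.
    lra.
  by rewrite /C addrAC lerDr addr_ge0 ?ler01// divr_ge0 ?(ltW k0)// mulr_ge0.
rewrite ler_pdivlMl; last by rewrite addr_gt0.
have h : 2 / (G * C) * a <= 2 / g * S.
  apply: (@le_trans _ _ (2 / G * S)).
    rewrite (_ : 2 / (G * C) * a = 2 / G * (a / C));
      last by field; rewrite !gt_eqF.
    by rewrite ler_wpM2l ?divr_ge0 ?(ltW G0)// ler_pdivrMr// mulrC.
  by rewrite ler_wpM2r// ler_wpM2l// lef_pV2// posrE.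
have : 2 / g * bif M x (max_bids M) <= - (2 / g * S).
  by rewrite -mulrN ler_wpM2l// divr_ge0// ltW.
rewrite mulrDl mul1r; lra.
Qed.

(** * Profit maximisation at the maximal bids, and the limit of the iterates *)

Lemma profit_max_bids {R : realType} (M : market R) (i : 'I_2) (b c : R) :
  (forall i, 0 < costA M i) ->
  0 <= 2 * costA M (rev_ord i) + costB M i
       - 2 * bmax M i + bmax M (rev_ord i) ->
  b <= bmax M i -> c <= cmax M i ->
  profit M i b (bmax M (rev_ord i)) c <=
  profit M i (bmax M i) (bmax M (rev_ord i)) (cmax M i).
Proof.
move=> hA Gi hb hc; rewrite /profit; apply: lerD => //; rewrite /quantity.
move: (hA i) (hA (rev_ord i)) Gi hb.
move: (costA M i) (costA M (rev_ord i)) (bmax M i) (bmax M (rev_ord i)).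
move=> Ai Ao bi bo Ai0 Ao0 Gi hb; rewrite -subr_ge0; set t := (X in 0 <= X).
(* Profit is a concave quadratic in the own slope [b]. The first summand of the bracket, over
   [2 * (Ai + Ao)], is its derivative at [bi], nonnegative by [Gi]. *)
have -> : t = (bi - b) * ((2 * Ao + costB M i - 2 * bi + bo) + (bi - b))
    / (2 * (Ai + Ao)).
  by rewrite /t; field; rewrite !gt_eqF// addr_gt0.
apply: divr_ge0; last by rewrite ltW// mulr_gt0// addr_gt0.
by apply: mulr_ge0; [|apply: addr_ge0 => //]; rewrite subr_ge0.
Qed.

Lemma normH_lt_sqr {R : realType} (x : bidpair R) (e : R) :
  normH x < e -> innerH x x < e ^+ 2.
Proof.
move=> xe; have e0 : 0 < e by exact: le_lt_trans (sqrtr_ge0 _) xe.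
rewrite -(sqr_sqrtr (innerH_ge0 x)).
by rewrite ltrXn2r ?nnegrE ?sqrtr_ge0 ?(ltW e0).
Qed.

Theorem proposition9 (R : realType) (M : market R)
  (hp : forall i j, pmin M i j <= pmax M i j)
  (hp01 : forall i, pmax M i ord0 < pmin M i ord_max)
  (hb : forall i, 0 <= bmin M i <= bmax M i)
  (hc : forall i, 0 <= cmin M i <= cmax M i)
  (hcp : forall i, pmax M i ord0 <= cmax M i)
  (hA : forall i, 0 < costA M i)
  (hB : forall i, 0 < costB M i)
  (hbmax : forall i, 0 < bmax M i)
  (hcmax : forall i, 0 < cmax M i)
  (hcond :
    (2 * bmax M ord0 <= bmax M ord_max /\
     0 <= 2 * costA M ord0 + costB M ord_max
          + bmax M ord0 - 2 * bmax M ord_max) \/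
    (2 * bmax M ord_max <= bmax M ord0 /\
     0 <= 2 * costA M ord_max + costB M ord0
          - 2 * bmax M ord0 + bmax M ord_max))
  (gamma : nat -> R)
  (hgamma_pos : forall k, 0 < gamma k)
  (hgamma_bnd : bounded_fun gamma)
  (y : nat -> 'I_2 -> quad R)
  (hy : proximal_point M gamma y)
  (ytilde : bidpair R)
  (hytilde : inH ytilde)
  (hcluster : cluster_point (fun k => quads (y k)) ytilde) :
  projected_solution M (projH (calC M) ytilde).
Proof.
(* Each alternative of [hcond] states one inequality outright; its comparison of the [bmax] gives
   the other, as costs are positive. *)
have [G1 G2] : 0 <= 2 * costA M ord_max + costB M ord0
             - 2 * bmax M ord0 + bmax M ord_max /\
    0 <= 2 * costA M ord0 + costB M ord_max
             + bmax M ord0 - 2 * bmax M ord_max.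
  have := hA ord0; have := hA ord_max; have := hB ord0; have := hB ord_max.
  by move=> ? ? ? ?; case: hcond => -[? ?]; split; lra.
have [G gammaG] := bounded_fun_has_ubound hgamma_bnd.
have {}gammaG k : gamma k <= G by apply: gammaG; exists k.
have [r [/andP[r0 r1] contr]] := prox_contract M G hp hb hc hcp hA G1 G2.
pose a k := innerH (quads (max_bids M) - quads (y k))
                   (quads (max_bids M) - quads (y k)).
(* The start [y 0] may have leading coefficients other than [costA M]; the contraction holds from
   any [u], hence already at the first step. *)
have ar k : a k <= r ^+ k * a 0%N.
  elim: k => [|k IH]; first by rewrite expr0 mul1r.
  apply: (@le_trans _ _ (r * a k)); last by rewrite exprS -mulrA ler_wpM2l.
  by apply: (contr (gamma k)); rewrite ?hgamma_pos ?gammaG// hy.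
have a_small e : 0 < e -> exists N, forall k, (N <= k)%N -> a k < e.
  move=> e0; have : a 0%N * r ^+ k @[k --> \oo] --> (0 : R).
    by apply: cvg_geometric; rewrite ger0_norm.
  move=> /cvgr_lt /(_ _ e0) [N _ hN]; exists N => k Nk.
  by rewrite (le_lt_trans (ar k))// mulrC; exact: hN.
have dist0 :
    innerH (quads (max_bids M) - ytilde) (quads (max_bids M) - ytilde) = 0.
  apply/eqP; rewrite eq_le innerH_ge0 andbT.
  apply/ler_addgt0Pr => e e0; rewrite add0r.
  (* Both squared distances, from the maximal bids to [y k] and from [y k] to [ytilde], are below
     [e / 4], and [innerH_sqrD_le] doubles each. *)
  have e4 : 0 < e / 4 by rewrite divr_gt0.
  have [N aN] := a_small _ e4.
  have [|k Nk yk] := hcluster (Num.sqrt (e / 4)) _ N; first by rewrite sqrtr_gt0.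
  have {}yk := normH_lt_sqr _ _ yk; rewrite sqr_sqrtr ?ltW// in yk.
  have {}aN := aN k Nk; rewrite /a in aN.
  rewrite -(subrK (quads (y k)) (quads (max_bids M))) -addrA.
  apply: le_trans (innerH_sqrD_le _ _ _ _) _.
  - by apply: inHB; exact: inH_quads.
  - by apply: inHB => //; exact: inH_quads.
  - lra.
(* [ytilde] is only known to be at distance zero from the maximal bids, so it is replaced inside the
   projection alone. *)
have -> : projH (calC M) ytilde = projH (calC M) (quads (max_bids M)).
  by apply/esym/projH_null => //; exact: inH_quads.
have Cphi := calC_projH M _ hp (inH_quads (max_bids M)).
split => //; exists (max_bids M); split => //; first exact: calK_max_bids.
have rev0 : rev_ord ord0 = ord_max :> 'I_2 by exact: val_inj.
have rev1 : rev_ord ord_max = ord0 :> 'I_2 by exact: val_inj.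
move=> i z [_ /andP[_ zb] /andP[_ zc] _]; apply: profit_max_bids => //.
by move: i {zb zc}; apply: ord2_ind; rewrite ?rev0 ?rev1//; lra.
Qed.
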